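(* Let $k$ be an odd positive integer and let $n$ be an integer with $\gcd(n,k)=\gcd(n+1,k)=1$. Let $N_k(n)$ be the number of pairs of positive integers $(b_1,b_2)$ such that $b_1\le (k-1)/2$, $b_2\le (k-1)/2$, $b_1+b_2\ge (k+1)/2$, and $b_2\equiv n b_1 \pmod{k}$. Then \[ N_k(n)\equiv \left\lfloor \frac{k+1}{4}\right\rfloor \pmod 2. \] *)

(* Defs.v *)
From mathcomp Require Import all_boot all_order all_algebra.

Set Implicit Arguments.
Unset Strict Implicit.
Unset Printing Implicit Defensive.

(* The index type 'I_k bounds b1, b2 by k - 1, which loses nothing for k > 0
   since b1, b2 <= (k - 1) / 2 <= k - 1.  For odd k the divisions by 2 are
   exact and k - 1 is not truncated. *)
Definition Npairs (k : nat) (n : int) : nat :=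
  #|[set b : 'I_k * 'I_k |
      [&& (0 < b.1)%N, (0 < b.2)%N,
          (b.1 <= (k - 1) %/ 2)%N, (b.2 <= (k - 1) %/ 2)%N,
          ((k + 1) %/ 2 <= b.1 + b.2)%N
        & ((b.2 : nat)%:Z == n * (b.1 : nat)%:Z %[mod k%:Z])%Z]]|.

(* Main.v *)
Require Import Defs.
From mathcomp Require Import all_boot all_order all_algebra.
From mathcomp Require Import zify.

(** For [0 < b <= (k - 1) / 2] the least absolute residues of [b], [n b] and
    [-(n + 1) b] add up to [0] or [±k], and [±k] occurs exactly when [b] is
    the first entry of a counted pair.  As [k] is odd, [N_k(n)] has the parity
    of the sum over [b] of the absolute values of these residues.  As in
    Gauss's lemma each of the three absolute values runs over
    [1, ..., (k - 1) / 2], so this sum is three times a triangular number. *)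

(** The distance from [x] to the nearest multiple of [k]. It does not see the sign of [x], so the
    residue of [-(n + 1) b] can be taken at [c.+1 * b], within [nat]. *)
Definition abs_residue (k x : nat) : nat := minn (x %% k) (k - x %% k).

Definition lower_half (k : nat) : {set 'I_k} :=
  [set i : 'I_k | (0 < i) && (i <= (k - 1) %/ 2)].

Lemma abs_residue_lt k x : 0 < k -> abs_residue k x < k.
Proof. by move=> k0; rewrite /abs_residue; have := ltn_pmod x k0; lia. Qed.

Lemma abs_residue_half k x :
  odd k -> ~~ (k %| x) -> 0 < abs_residue k x <= (k - 1) %/ 2.
Proof.
move=> ko; rewrite /dvdn /abs_residue -lt0n => x0.
have k0 : 0 < k by case: k ko {x0}.
by have := ltn_pmod x k0; lia.
Qed.

Lemma abs_residue_eq k x y : 0 < k -> x <= y ->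
  abs_residue k x = abs_residue k y -> (k %| y - x) || (k %| x + y).
Proof.
move=> k0 xy; rewrite /abs_residue => e.
have hx := ltn_pmod x k0; have hy := ltn_pmod y k0.
have [er | er] : x %% k = y %% k \/ x %% k + y %% k = k by lia.
  by rewrite -eqn_mod_dvd // er eqxx.
by rewrite orbC /dvdn -modnDm er modnn.
Qed.

(** Equal values at [i] and [j] would make [k] divide [c * (j - i)] or [c * (i + j)]. Hence the map
    is injective from the lower half to itself, so it permutes it. *)
Lemma sum_abs_residue k c : odd k -> coprime c k ->
  \sum_(i in lower_half k) abs_residue k (c * i) = \sum_(i in lower_half k) i.
Proof.
move=> ko cop; have k0 : 0 < k by case: k ko {cop}.
have ndvd i : 0 < i < k -> ~~ (k %| c * i).
  move=> /andP[i0 ik]; rewrite Gauss_dvdr; last by rewrite coprime_sym.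
  by rewrite gtnNdvd.
pose f (i : 'I_k) := Ordinal (abs_residue_lt k (c * i) k0).
have finj : {in lower_half k &, injective f}.
  move=> i j; rewrite !inE => /andP[i0 im] /andP[j0 jm] /(congr1 val) /= e.
  apply/val_inj => /=.
  wlog ij : i j i0 im j0 jm e / i <= j.
    move=> H; case: (leqP i j) => [|/ltnW] ij; first exact: H.
    by apply/esym/H.
  have := abs_residue_eq k _ _ k0 (leq_mul (leqnn c) ij) e.
  rewrite -mulnBr -mulnDr => /orP[] d; last first.
    (* Both indices are at most [(k - 1) / 2], so [0 < i + j < k]. *)
    by have /negP := ndvd (i + j) ltac:(lia).
  apply/eqP; rewrite eqn_leq ij /=; apply: contraLR d => ji.
  by apply: ndvd; have := ltn_ord j; lia.
have fim : f @: lower_half k = lower_half k.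
  apply/eqP; rewrite eqEcard card_in_imset // leqnn andbT.
  apply/subsetP=> _ /imsetP[i + ->]; rewrite !inE => /andP[i0 im] /=.
  by apply: abs_residue_half => //; apply: ndvd; rewrite i0 ltn_ord.
by rewrite -[in RHS]fim big_imset.
Qed.

(** Both sides hold exactly when [m] is 1 or 2 modulo 4. *)
Lemma odd_sum_ord m : odd (\sum_(i < m.+1) i) = odd (m.+1 %/ 2).
Proof.
elim: m => [|m IH]; first by rewrite big_ord_recr big_ord0.
by rewrite big_ord_recr oddD IH /=; lia.
Qed.

Lemma sum_lower_half k : 0 < k ->
  \sum_(i in lower_half k) i = \sum_(i < ((k - 1) %/ 2).+1) i.
Proof.
move=> k0; have mk : ((k - 1) %/ 2).+1 <= k by lia.
rewrite (big_ord_widen k (fun i => i) mk) [RHS](bigID (fun i : 'I_k => 0 < i)) /=.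
rewrite [X in _ = _ + X]big1 ?addn0; last by move=> i; lia.
by apply: eq_bigl => i; rewrite inE ltnS andbC.
Qed.

(** With [r = c * b %% k], the sum is the odd number [k] when the right side holds. Otherwise it is
    [2(b + r)] for [r] in the lower half, and for larger [r] it is [2(k - r)] or [2b] according to
    whether [b + r < k]. *)
Lemma odd_abs_residue_sum k c b : odd k -> 0 < b <= (k - 1) %/ 2 ->
  odd (b + abs_residue k (c * b) + abs_residue k (c.+1 * b)) =
  (c * b %% k <= (k - 1) %/ 2) && ((k + 1) %/ 2 <= b + c * b %% k).
Proof.
move=> ko /andP[b0 bm]; have k0 : 0 < k by lia.
rewrite /abs_residue mulSn -(modnDmr b).
set r := c * b %% k; have rk : r < k by apply: ltn_pmod.
have -> : (b + r) %% k = if b + r < k then b + r else b + r - k.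
  case: ltnP => h; first by rewrite modn_small.
  by rewrite -{1}(subnK h) modnDr modn_small //; lia.
by case: ltnP; lia.
Qed.

(** The congruence determines the second entry from the first, so pairs are counted by their first
    entry. *)
Lemma Npairs_sum k n c : 0 < k -> (c%:Z = n %% k%:Z)%Z ->
  Npairs k n = \sum_(i in lower_half k)
    ((c * i %% k <= (k - 1) %/ 2) && ((k + 1) %/ 2 <= i + c * i %% k)).
Proof.
move=> k0 cE.
pose g (i : 'I_k) := (i, Ordinal (ltn_pmod (c * i) k0)).
pose A := [set i in lower_half k |
  (c * i %% k <= (k - 1) %/ 2) && ((k + 1) %/ 2 <= i + c * i %% k)].
have eqm (i j : 'I_k) :
    ((j : nat)%:Z == (n * (i : nat)%:Z)%R %[mod k%:Z])%Z = (j == c * i %% k :> nat).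
  rewrite -modzMml -cE -PoszM !modz_nat eqz_nat modn_small //.
have -> : Npairs k n = #|A|.
  rewrite -(card_imset (mem A) (f := g)); last by move=> i j [].
  apply: eq_card => -[i j]; rewrite inE /= eqm.
  apply/idP/imsetP => [/and5P[i0 j0 im jm /andP[s /eqP e]] | [i' + [-> /(congr1 val) /= e]]].
    exists i; first by rewrite !inE -e i0 im jm s.
    by congr pair; apply/val_inj.
  rewrite !inE -e => /andP[/andP[i0 im] /andP[jm s]].
  (* Positivity of the second entry follows from [i <= (k - 1) / 2 < (k + 1) / 2]. *)
  by rewrite i0 im jm s eqxx /= andbT; lia.
rewrite -sum1_card (eq_bigl (fun i => (i \in lower_half k) &&
  ((c * i %% k <= (k - 1) %/ 2) && ((k + 1) %/ 2 <= i + c * i %% k)))).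
  by rewrite big_mkcondr; apply: eq_bigr => i _; case: (_ && _).
by move=> i; rewrite [LHS]inE.
Qed.

Theorem theorem1p2 (k : nat) (n : int) (k_gt0 : (0 < k)%N) (k_odd : odd k)
    (gcd_n : gcdz n k%:Z = 1%R) (gcd_n1 : gcdz (n + 1)%R k%:Z = 1%R) :
  Npairs k n = (k + 1) %/ 4 %[mod 2].
Proof.
have [c cE] : {c : nat | (c%:Z = n %% k%:Z)%Z}.
  exists `|(n %% k%:Z)%Z|%N; rewrite gez0_abs // modz_ge0 //; lia.
have cop : coprime c k.
  by move: gcd_n; rewrite -gcdz_modl -cE => -[/eqP].
have cop1 : coprime c.+1 k.
  move: gcd_n1; rewrite -gcdz_modl -modzDml -cE gcdz_modl -PoszD addn1.
  by move=> -[/eqP].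
rewrite !modn2; congr nat_of_bool.
rewrite (Npairs_sum k n c) // (big_morph odd oddD (erefl _)).
under eq_bigr => i.
  rewrite inE oddb => iM; rewrite -(odd_abs_residue_sum _ _ _ k_odd iM); over.
rewrite -(big_morph odd oddD (erefl _)) !big_split /= !sum_abs_residue //.
(* Two of the three equal sums cancel modulo 2; the remaining one has [m = (k - 1) / 2], and
   [m + 1 = (k + 1) / 2] is halved once more. *)
rewrite !oddD addbb addFb sum_lower_half // odd_sum_ord.
congr odd; lia.
Qed.
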